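(* The class of eventually dendric shift spaces is closed under conjugacy: if $X$ is an eventually dendric shift space and $Y$ is a shift space conjugate to $X$, then $Y$ is eventually dendric.
   Context: A shift space over a finite alphabet $A$ is a closed subset $X\subseteq A^{\mathbb Z}$ with $\sigma(X)=X$, $\sigma$ the shift; $\mathcal L(X)$ is its set of finite factors. A sliding block code $\phi:X\to Y$ (with $Y\subseteq B^{\mathbb Z}$) is a map for which there exist $m,n\ge0$ and $f:\mathcal L_{m+n+1}(X)\to B$ with $\phi(x)_i=f(x_{i-m}\cdots x_{i+n})$ for all $i\in\mathbb Z$; $X$ and $Y$ are conjugate if there is a bijective sliding block code $X\to Y$. For $w\in\mathcal L(X)$ the extension graph $\mathcal E_1(w)$ is the undirected bipartite graph with vertex set the disjoint union of $\{a\in A: aw\in\mathcal L(X)\}$ and $\{b\in A: wb\in\mathcal L(X)\}$ and an edge $(a,b)$ iff $awb\in\mathcal L(X)$. $X$ is eventually dendric if for some $m\ge0$, $\mathcal E_1(w)$ is a tree for every $w\in\mathcal L(X)$ of length $\ge m$. *)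

(* Defs.v *)
From Stdlib Require Import ZArith Relations.
From mathcomp Require Import all_boot.
Set Implicit Arguments. Unset Strict Implicit. Unset Printing Implicit Defensive.

Definition config (A : Type) := Z -> A.

Definition shift (A : Type) (x : config A) : config A := fun i => x (i + 1)%Z.

Definition window (A : Type) (x : config A) (i : Z) (n : nat) : seq A :=
  mkseq (fun k => x (i + Z.of_nat k)%Z) n.

(* Closedness in the product topology on A^Z (A discrete finite): x lies in X
   as soon as every central cylinder [x_{-n} .. x_n] around x meets X. *)
Definition closed_set (A : finType) (X : config A -> Prop) : Prop :=
  forall x : config A,
    (forall n : nat, exists y, X y /\
        forall i : Z, (- Z.of_nat n <= i <= Z.of_nat n)%Z -> y i = x i) ->
    X x.

Definition shift_invariant (A : finType) (X : config A -> Prop) : Prop :=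
  forall y : config A,
    X y <-> exists x, X x /\ forall i, y i = shift x i.

Definition shift_space (A : finType) (X : config A -> Prop) : Prop :=
  closed_set X /\ shift_invariant X.

Definition Lang (A : finType) (X : config A -> Prop) (w : seq A) : Prop :=
  exists x, X x /\ exists i : Z, window x i (size w) = w.

Definition sliding_block_code (A B : finType) (X : config A -> Prop)
    (Y : config B -> Prop) (phi : config A -> config B) : Prop :=
  (forall x, X x -> Y (phi x)) /\
  exists (m n : nat) (f : seq A -> B),
    forall x, X x -> forall i : Z,
      phi x i = f (window x (i - Z.of_nat m)%Z (m + n + 1)).

Definition conjugate (A B : finType) (X : config A -> Prop)
    (Y : config B -> Prop) : Prop :=
  exists phi : config A -> config B,
    sliding_block_code X Y phi /\
    (forall x x', X x -> X x' -> (forall i, phi x i = phi x' i) ->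
                  forall i, x i = x' i) /\
    (forall y, Y y -> exists x, X x /\ forall i, phi x i = y i).

Definition ext_vertex (A : finType) (X : config A -> Prop) (w : seq A)
    (u : A + A) : Prop :=
  match u with
  | inl a => Lang X (a :: w)
  | inr b => Lang X (rcons w b)
  end.

Definition ext_edge (A : finType) (X : config A -> Prop) (w : seq A)
    (u v : A + A) : Prop :=
  match u, v with
  | inl a, inr b => Lang X (a :: rcons w b)
  | inr b, inl a => Lang X (a :: rcons w b)
  | _, _ => False
  end.

Fixpoint walk (T : Type) (e : T -> T -> Prop) (x : T) (p : seq T) : Prop :=
  match p with
  | [::] => True
  | y :: p' => e x y /\ walk e y p'
  end.

(* Graph on vertex set V with (symmetric) edge relation e. *)
Definition graph_connected (T : Type) (V : T -> Prop) (e : T -> T -> Prop) :=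
  forall u v, V u -> V v -> clos_refl_trans T e u v.

Definition graph_acyclic (T : eqType) (V : T -> Prop) (e : T -> T -> Prop) :=
  forall (x : T) (p : seq T), (forall z, z \in x :: p -> V z) ->
    uniq (x :: p) -> (2 <= size p)%N -> ~ walk e x (rcons p x).

Definition graph_tree (T : eqType) (V : T -> Prop) (e : T -> T -> Prop) :=
  graph_connected V e /\ graph_acyclic V e.

Definition ext_graph_tree (A : finType) (X : config A -> Prop) (w : seq A) :=
  graph_tree (ext_vertex X w) (ext_edge X w).

Definition eventually_dendric (A : finType) (X : config A -> Prop) : Prop :=
  exists m : nat, forall w : seq A, Lang X w -> (m <= size w)%N ->
    ext_graph_tree X w.

(* Main.v *)
Require Import Defs.
From Stdlib Require Import ZArith Relations.
From mathcomp Require Import boolp classical_sets filter.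
From mathcomp Require Import all_boot zify.

Set Implicit Arguments.
Unset Strict Implicit.
Unset Printing Implicit Defensive.

(** Acyclicity of the extension graphs says that the left excess of a word (its
    number of left extensions minus one) is at least the sum of the excesses of
    its one-letter right extensions, and this passes to the excess counting left
    extensions of length [k].  As these are natural numbers, for long words [w]
    the whole excess goes to a single right extension.  Together with the mirror
    argument, the extension graph of [w] with respect to words of length [k] is
    eventually a double star: [u w z] is a factor iff [u = u0] or [z = z0].  With
    [k = 2 r + 1], where [r] is a radius for the conjugacy and its inverse, the
    extension graph of a long word of [Y] is a projection of part of a double
    star for [X]; this is again a double star, hence a tree. *)

(** * Cycle-free graphs *)

(** Size at least 3 excludes the closed walk along one edge and back. *)
Definition cycle_free (V : eqType) (e : rel V) :=
  forall s : seq V, uniq s -> 2 < size s -> ~~ cycle e s.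

(** A path inside [S] is grown at its head [x]: a neighbour of [x] other than the second vertex
    either is new or closes a cycle, and a path cannot outgrow [V]. Growing at the head is what
    reverses the relation. *)
Lemma min_degree2_cycle (V : finType) (e : rel V) (S : {set V}) :
  irreflexive e -> S != set0 ->
  (forall x z, x \in S -> exists2 y, y \in S & e x y && (y != z)) ->
  exists s, [/\ uniq s, 2 < size s & cycle (fun x y => e y x) s].
Proof.
move=> irr /set0Pn[x0 x0S] deg2.
pose e' := fun x y => e y x.
have [//|nocyc] := pselect (exists s, [/\ uniq s, 2 < size s & cycle e' s]).
have long n : exists x p, [/\ uniq (x :: p), path e' x p, size p = n & x \in S].
  elim: n => [|n [x [p [up pp sp xS]]]]; first by exists x0, [::].
  have [y yS /andP[exy yp]] := deg2 x (head x p) xS.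
  have yx : y != x by apply: contraTneq exy => ->; rewrite irr.
  have [yin|yN] := boolP (y \in p); last first.
    exists y, (x :: p); split=> //=; last by rewrite sp.
      by rewrite inE negb_or yx yN.
    by rewrite /e' exy.
  case/splitPr: yin up pp sp yp => p1 p2 up pp sp yp.
  case: nocyc; exists (x :: rcons p1 y); split.
  - by move: up; rewrite -cat_rcons -cat_cons cat_uniq => /and3P[].
  - by case: p1 yp {up pp sp} => [|? ?] /=; rewrite ?eqxx // size_rcons.
  - move: pp; rewrite -cat_rcons cat_path => /andP[pp _].
    by rewrite /= rcons_path pp last_rcons.
have [x [p [up _ sp _]]] := long #|V|.
by move/card_uniqP: up (max_card (mem (x :: p))) => -> /=; rewrite sp ltnn.
Qed.

(** Edge bound for forests: remove a vertex with at most one neighbour in [S] and induct. The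
    orientation [d] counts each edge once. *)
Lemma cycle_free_edges (V : finType) (d : rel V) (S : {set V}) :
  (forall x y, d x y -> ~~ d y x) ->
  cycle_free (fun x y => d x y || d y x) ->
  \sum_(x in S) \sum_(y in S) d x y <= #|S|.-1.
Proof.
move=> asym acyc; set e := fun x y => d x y || d y x.
have irr x : d x x = false by apply/negP=> dx; have /negP := asym _ _ dx.
have [n] := ubnP #|S|; elim: n S => // n IH S.
have [->|S0] := eqVneq S set0; first by rewrite big_set0.
move=> ltS.
have [x [z [xS xz]]] : exists x z, x \in S /\ forall y, y \in S -> e x y -> y = z.
  apply: contrapT => hS.
  have [||s [us ss cs]] := @min_degree2_cycle V e S _ S0.
  - by move=> x; rewrite /e irr.
  - move=> x z xS; apply: contrapT => hx; apply: hS; exists x, z; split=> // y yS exy.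
    by apply/eqP/negPn/negP => yz; apply: hx; exists y; rewrite ?exy.
  - have /negP := acyc s us ss; apply; congr is_true: cs.
    by apply: eq_cycle => u v; rewrite /e orbC.
have lt1 : #|S :\ x| < n by rewrite (cardsD1 x) xS in ltS.
have {}IH := IH _ lt1.
rewrite (big_setD1 x) //= (big_setD1 x) //= irr add0n.
under [X in _ + X <= _]eq_bigr => y _ do rewrite (big_setD1 x) //=.
rewrite big_split /= addnA -big_split /=.
have [S1|S1] := eqVneq (S :\ x) set0.
  by rewrite S1 !big_set0.
have : \sum_(i in S :\ x) (d x i + d i x) <= 1.
  have [zS|zS] := boolP (z \in S :\ x).
    rewrite (big_setD1 z) //= big1 ?addn0.
      by have := asym x z; case: (d x z); case: (d z x) => // /(_ isT).
    move=> y; rewrite !inE => /and3P[yz yx yS].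
    have := xz y yS; rewrite /e; case: (d x y); case: (d y x) => //= h;
      by rewrite h ?eqxx in yz.
  rewrite big1 // => y yS; move: (yS); rewrite inE => /andP[_ /xz].
  rewrite /e; case: (d x y); case: (d y x) => //= h;
  by rewrite -h // yS in zS.
by rewrite (cardsD1 x S) xS; move: S1; rewrite -card_gt0; lia.
Qed.

(** This is the forest bound on the non-isolated vertices, with one unit per non-isolated [b]
    cancelled on both sides. *)
Lemma bipartite_cycle_free_excess (A B : finType) (e : A -> B -> bool) :
  cycle_free (fun x y : A + B => match x, y with
    | inl a, inr b => e a b | inr b, inl a => e a b | _, _ => false end) ->
  \sum_b (\sum_a e a b).-1 <= (\sum_a [exists b, e a b]).-1.
Proof.
move=> acyc.
pose d (x y : A + B) := match x, y with inl a, inr b => e a b | _, _ => false end.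
pose S := [set x : A + B | match x with
  | inl a => [exists b, e a b] | inr b => [exists a, e a b] end].
have := @cycle_free_edges _ d S.
have -> : \sum_(x in S) \sum_(y in S) d x y = \sum_b \sum_a e a b.
  rewrite big_mkcond big_sumType /= [X in _ + X]big1 ?addn0; last first.
    by move=> b _; case: ifP => // _; rewrite big1.
  rewrite [RHS]exchange_big; apply: eq_bigr => a _.
  rewrite [in LHS]big_mkcond big_sumType /=.
  rewrite [X in if _ then X + _ else _]big1 => [|? _]; last by case: ifP.
  rewrite inE; case: ifP => [_|/existsP aN].
    rewrite add0n; apply: eq_bigr => b _; rewrite inE.
    by case: ifP => // /existsP bN; case: (boolP (e a b)) => // eab; case: bN; exists a.
  by rewrite big1 // => b _; case: (boolP (e a b)) => // eab; case: aN; exists b.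
have -> : #|S| = \sum_a [exists b, e a b] + \sum_b [exists a, e a b].
  rewrite -sum1_card big_mkcond /= big_sumType /=.
  by congr (_ + _); apply: eq_bigr => x _; rewrite inE; case: ifP.
have -> : \sum_b \sum_a e a b
          = \sum_b (\sum_a e a b).-1 + \sum_b [exists a, e a b].
  rewrite -big_split; apply: eq_bigr => b _ /=.
  have [/existsP[a eab]|/existsPn bN] := boolP [exists a, e a b].
    by rewrite addn1 prednK // (bigD1 a) //= eab.
  by rewrite big1 // => a _; rewrite (negbTE (bN a)).
set P := \sum_b _.-1; set Q := \sum_b _; set R := \sum_a _ => h.
suff : P + Q <= (R + Q).-1 by lia.
apply: h => [[a|b] [a'|b']|] //.
move=> s us ss; apply: contra (acyc s us ss); congr is_true.
by apply: eq_cycle => -[a|b] [a'|b'] //=; rewrite ?orbF.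
Qed.

(** * Concentration of the excess *)

Definition language (A : finType) (L : pred (seq A)) :=
  [/\ forall u v, L (u ++ v) -> L u /\ L v,
      forall w, L w -> exists a, L (a :: w)
    & forall w, L w -> exists b, L (rcons w b)].

Lemma language_rev (A : finType) (L : pred (seq A)) :
  language L -> language (L \o rev).
Proof.
move=> [fac extl extr]; split=> [u v|w|w] /=.
- by rewrite rev_cat => /fac[].
- by move=> /extr[b]; exists b; rewrite rev_cons.
- by move=> /extl[a]; exists a; rewrite rev_rcons.
Qed.

Lemma language_rcons (A : finType) (L : pred (seq A)) w b :
  language L -> L (rcons w b) -> L w.
Proof. by move=> [fac _ _]; rewrite -cats1 => /fac[]. Qed.

Lemma language_ext_left (A : finType) (L : pred (seq A)) k w :
  language L -> L w -> exists2 u, size u = k & L (u ++ w).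
Proof.
move=> [_ extl _] Lw; elim: k => [|k [u su /extl[a La]]]; first by exists [::].
by exists (a :: u); rewrite /= ?su.
Qed.

Definition left_excess (A : finType) (L : pred (seq A)) (w : seq A) : nat :=
  (\sum_a L (a :: w)).-1.

(* For [w] in [L] this is the number of words [u] of length [k] with [u ++ w]
   in [L], minus one. *)
Fixpoint excess (A : finType) (L : pred (seq A)) (k : nat) (w : seq A) : nat :=
  if k is k'.+1 then left_excess L w + \sum_a excess L k' (a :: w) else 0.

(** A mass on the tree of words growing to the right: from length [m] on, the children together
    weigh at most as much as their parent. *)
Definition superadditive (A : finType) (m : nat) (F : seq A -> nat) :=
  forall w, m <= size w -> \sum_b F (rcons w b) <= F w.

Lemma superadditive_le (A : finType) m (F : seq A -> nat) w b :
  superadditive m F -> m <= size w -> F (rcons w b) <= F w.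
Proof. by move=> sF /sF; apply: leq_trans; rewrite (bigD1 b) //= leq_addr. Qed.

(** Extending on the left commutes with extending on the right, so exchanging the two sums gives the
    induction on [k]. *)
Lemma excess_superadditive (A : finType) (L : pred (seq A)) m k :
  superadditive m (left_excess L) -> superadditive m (excess L k).
Proof.
move=> sL; elim: k => [|k IH] w mw /=; first by rewrite big1.
rewrite big_split /= leq_add ?sL // exchange_big /= leq_sum // => a _.
by apply: IH; rewrite /= ltnW.
Qed.

Lemma left_excess_eq0 (A : finType) (L : pred (seq A)) w a b :
  left_excess L w = 0 -> L (a :: w) -> L (b :: w) -> a = b.
Proof.
rewrite /left_excess => e0 La Lb; apply/eqP/negPn/negP => ab.
by move: e0; rewrite (bigD1 a) //= (bigD1 b) 1?eq_sym //= La Lb.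
Qed.

(** With zero excess each letter added on the left is forced, starting from the one next to [w]. *)
Lemma excess_eq0 (A : finType) (L : pred (seq A)) k w u v :
  language L -> excess L k w = 0 -> size u = k -> size v = k ->
  L (u ++ w) -> L (v ++ w) -> u = v.
Proof.
move=> [fac _ _]; elim: k w u v => [|k IH] w u v /=; first by case: u v => [|//] [].
move=> /eqP; rewrite addn_eq0 sum_nat_eq0 => /andP[/eqP e1 /forallP e0].
case/lastP: u => // u a; case/lastP: v => // v b.
rewrite !size_rcons !cat_rcons => -[su] [sv] Lu Lv.
have [_ La] := fac _ _ Lu; have [_ Lb] := fac _ _ Lv.
move: Lv; rewrite -(left_excess_eq0 e1 La Lb) => Lv.
by rewrite (IH (a :: w) u v) //; apply/eqP/e0.
Qed.

Lemma excess_gt0 (A : finType) (L : pred (seq A)) k w :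
  language L -> 0 < excess L k w -> L w.
Proof.
move=> [fac _ _]; elim: k w => //= k IH w; rewrite addn_gt0 => /orP[]; last first.
  rewrite lt0n sum_nat_eq0 negb_forall => /existsP[a]; rewrite -lt0n => /IH.
  by rewrite -cat1s => /fac[].
apply: contraTT => Lw; rewrite /left_excess big1 // => a _.
by case: (boolP (L _)) => //; rewrite -cat1s => /fac[_]; rewrite (negbTE Lw).
Qed.

(** No term of the excess can grow when [b] is appended, so equality of the totals is equality term
    by term, and no left extension is lost. *)
Lemma excess_full (A : finType) (L : pred (seq A)) m k w b u :
  language L -> superadditive m (left_excess L) -> m <= size w ->
  excess L k (rcons w b) = excess L k w -> L (rcons w b) ->
  size u = k -> L (u ++ w) -> L (u ++ rcons w b).
Proof.
move=> lang sL; have [fac extl _] := lang.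
elim: k w u => [|k IH] w u mw; first by case: u.
move=> /= eE Lwb; case/lastP: u => // u a; rewrite size_rcons !cat_rcons => -[su] Lu.
have le1 : left_excess L (rcons w b) <= left_excess L w.
  exact: superadditive_le b sL mw.
have le2 c : excess L k (rcons (c :: w) b) <= excess L k (c :: w).
  by apply: (superadditive_le b (excess_superadditive k sL)); rewrite /= ltnW.
have le3 : \sum_c excess L k (rcons (c :: w) b) <= \sum_c excess L k (c :: w).
  by apply: leq_sum.
have e1 : left_excess L (rcons w b) = left_excess L w by move: le1 le3 eE => /=; lia.
have e2 : excess L k (rcons (a :: w) b) = excess L k (a :: w).
  have: \sum_c excess L k (rcons (c :: w) b) = \sum_c excess L k (c :: w).
    by move: e1 eE => /=; lia.
  rewrite (bigD1 a) //= [RHS](bigD1 a) //=.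
  have : \sum_(c | c != a) excess L k (c :: rcons w b) <=
         \sum_(c | c != a) excess L k (c :: w).
    by apply: leq_sum => c _; exact: le2.
  by have := le2 a; rewrite /=; lia.
apply: (IH (a :: w)) => //; first by rewrite /= ltnW.
have [_ Law] := fac _ _ Lu; rewrite /=; apply: contrapT => /negP aN.
(* The left extension [c] makes the count for [rcons w b] positive, so the truncated predecessor in
   [left_excess] hides nothing. *)
have [c Lc] := extl _ Lwb.
have le c' : L (c' :: rcons w b) <= L (c' :: w).
  case: (boolP (L (c' :: rcons w b))) => // h.
  by rewrite (@language_rcons _ _ (c' :: w) b lang h).
move: e1; rewrite /left_excess (bigD1 a) //= (negbTE aN) add0n.
rewrite [in RHS](bigD1 a) //= Law.
have ca : c != a by apply: contraNneq aN => <-.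
have : \sum_(c | c != a) L (c :: rcons w b) <= \sum_(c | c != a) L (c :: w).
  by apply: leq_sum.
rewrite (bigD1 c) //= Lc; lia.
Qed.

(** * Level sums and concentration of mass *)

Fixpoint level_sum (A : finType) (g : seq A -> nat) (d : nat) (w : seq A) : nat :=
  if d is d'.+1 then \sum_b level_sum g d' (rcons w b) else g w.

Lemma level_sum_nonincreasing (A : finType) m (g : seq A -> nat) d w :
  superadditive m g -> m <= size w + d -> level_sum g d.+1 w <= level_sum g d w.
Proof.
move=> sg; elim: d w => [|d IH] w; first by rewrite addn0 => /sg.
by move=> mwd; apply: leq_sum => b _; apply: IH; rewrite size_rcons addSnnS.
Qed.

(** A level sum adds up terms indexed by the words [z] of length [d]. None of them grows at the next
    level, so equal totals force equality at every [z]. *)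
Lemma level_sum_stationary (A : finType) m (g : seq A -> nat) d w z :
  superadditive m g -> m <= size w + d -> level_sum g d.+1 w = level_sum g d w ->
  size z = d -> \sum_b g (rcons (w ++ z) b) = g (w ++ z).
Proof.
move=> sg; elim: d w z => [|d IH] w z mwd; first by case: z => //; rewrite cats0.
move=> e; case: z => // b z [sz]; rewrite -cat_rcons; apply: IH => //.
  by rewrite size_rcons addSnnS.
have le c : level_sum g d.+1 (rcons w c) <= level_sum g d (rcons w c).
  by apply: (level_sum_nonincreasing sg); rewrite size_rcons addSnnS.
apply/eqP; rewrite eqn_leq le /=.
move: e => /=; rewrite (bigD1 b) //= [in RHS](bigD1 b) //=.
have : \sum_(c | c != b) level_sum g d.+1 (rcons w c) <=
       \sum_(c | c != b) level_sum g d (rcons w c) by apply: leq_sum.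
move=> /=; lia.
Qed.

Lemma nonincreasing_stationary (f : nat -> nat) m :
  (forall d, m <= d -> f d.+1 <= f d) ->
  exists2 n, m <= n & forall d, n <= d -> f d.+1 = f d.
Proof.
move=> dec; have [k] := ubnP (f m); elim: k m dec => // k IH m dec fm.
have [[d md lt]|st] := pselect (exists2 d, m <= d & f d.+1 < f d).
  have le : f d <= f m.
    elim: d md {lt} => [|d IHd]; first by rewrite leqn0 => /eqP->.
    rewrite leq_eqVlt => /orP[/eqP->//|]; rewrite ltnS => md.
    by apply: leq_trans (IHd md); exact: dec.
  have [|| n mn st] := IH d.+1.
  - by move=> j /ltnW dj; apply: dec; apply: leq_trans dj.
  - by move: lt le fm; lia.
  - by exists n => //; apply: leq_trans mn; rewrite ltnW.
exists m => // d md; apply/eqP; rewrite eqn_leq dec //= leqNgt.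
by apply/negP=> lt; apply: st; exists d.
Qed.

Lemma superadditive_sqr (A : finType) m (F : seq A -> nat) :
  superadditive m F -> superadditive m (fun w => F w * F w).
Proof.
move=> sF w mw; apply: (@leq_trans (\sum_b F w * F (rcons w b))).
  by apply: leq_sum => b _; rewrite leq_mul2r (superadditive_le b sF) ?orbT.
by rewrite -big_distrr leq_mul2l /= sF ?orbT.
Qed.

(* The level sums of the squares decrease, and are stationary only if all the
   mass of a word goes to a single one of its extensions. *)
Lemma superadditive_concentrates (A : finType) m (F : seq A -> nat) :
  superadditive m F ->
  exists n, forall w, n <= size w -> 0 < F w ->
    exists2 b, F (rcons w b) = F w & forall c, c != b -> F (rcons w c) = 0.
Proof.
move=> sF; have sF2 := superadditive_sqr sF.
have [|n mn st] := @nonincreasing_stationary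
  (fun d => level_sum (fun w => F w * F w) d [::]) m.
  by move=> d md; exact: level_sum_nonincreasing sF2 _.
exists n => w nw Fw; have mw := leq_trans mn nw.
(* Stationarity of the sums issued from the empty word, read at [w]: the squares of the children of
   [w] add up to [F w * F w]. *)
have := @level_sum_stationary _ _ _ _ [::] w sF2 mw (st _ nw) erefl; rewrite /= => e.
have [b0 _] : exists b : A, true.
  case: (pickP (@predT A)) => [b _|A0]; first by exists b.
  by move: e; rewrite big_pred0 //; nia.
have [b _ bmax] := @arg_maxnP A b0 predT (fun b => F (rcons w b)) isT.
(* As [b] carries the largest mass, the sum of squares is at most [F (rcons w b)] times the total
   mass of the children. *)
have le : F w * F w <= F (rcons w b) * F w.
  rewrite -e; apply: (@leq_trans (\sum_c F (rcons w b) * F (rcons w c))).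
    by apply: leq_sum => c _; rewrite leq_mul2r; apply/orP; right; exact: bmax.
  by rewrite -big_distrr leq_mul2l /= sF ?orbT.
have eb : F (rcons w b) = F w.
  by apply/eqP; rewrite eqn_leq (superadditive_le b sF mw); rewrite leq_pmul2r in le.
exists b => // c cb; have := sF w mw.
by rewrite (bigD1 b) //= (bigD1 c) //= eb; lia.
Qed.

(** * Double stars in a language *)

(** If [w] has zero excess, its left extension [u] of length [k] is unique and any [b] that follows
    [u ++ w] works. Otherwise [b] is the letter that receives the whole excess. *)
Lemma right_concentration (A : finType) (L : pred (seq A)) m k :
  language L -> superadditive m (left_excess L) ->
  exists n, forall w, L w -> n <= size w -> exists b,
    (forall u, size u = k -> L (u ++ w) -> L (u ++ rcons w b)) /\
    (forall c u v, c != b -> size u = k -> size v = k ->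
       L (u ++ rcons w c) -> L (v ++ rcons w c) -> u = v).
Proof.
move=> lang sL.
have [n conc] := superadditive_concentrates (excess_superadditive k sL).
exists (maxn m n) => w Lw; rewrite geq_max => /andP[mw nw].
have [F0|] := posnP (excess L k w).
  have [u su Lu] := language_ext_left k lang Lw.
  have [_ _ extr] := lang; have [b Lb] := extr _ Lu.
  exists b; split=> [v sv Lv|c v v' _ sv sv'].
    by rewrite (excess_eq0 lang F0 sv su Lv Lu) -rcons_cat.
  rewrite -!rcons_cat => /(language_rcons lang) Lv /(language_rcons lang) Lv'.
  exact: excess_eq0 lang F0 sv sv' Lv Lv'.
move=> Fw; have [b eb c0] := conc w nw Fw; exists b; split=> [u|c u v /c0 F0].
  apply: (excess_full lang sL mw eb); apply: (@excess_gt0 _ _ k) => //.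
  by rewrite eb.
exact: excess_eq0 lang F0.
Qed.

(** The word [r] follows the concentrating letters one by one. Where [s] leaves [r], the left
    extension is already unique, and longer words inherit this. *)
Lemma right_concentration_words (A : finType) (L : pred (seq A)) m k l :
  language L -> superadditive m (left_excess L) ->
  exists n, forall w, L w -> n <= size w -> exists r,
    [/\ size r = l,
        forall u, size u = k -> L (u ++ w) -> L (u ++ w ++ r)
      & forall s u v, s != r -> size s = l -> size u = k -> size v = k ->
       L (u ++ w ++ s) -> L (v ++ w ++ s) -> u = v].
Proof.
move=> lang sL; have [n conc] := right_concentration k lang sL; have [fac _ _] := lang.
exists n; elim: l => [|l IH] w Lw nw.
  by exists [::]; split=> // [u _|[|//] //]; rewrite cats0.
have [b [full uniq]] := conc w Lw nw.
have Lwb : L (rcons w b).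
  have [u su Lu] := language_ext_left k lang Lw.
  by have /fac[] := full u su Lu.
have [|r [sr fullr uniqr]] := IH _ Lwb; first by rewrite size_rcons ltnW.
exists (b :: r); split=> [|u su Lu|[//|c s] u v]; first by rewrite /= sr.
  by rewrite -cat_rcons; apply: fullr => //; apply: full.
rewrite eqseq_cons -!cat_rcons => ne [ss] su sv Lu Lv.
have [ecb|cb] := eqVneq c b.
  by rewrite ecb in ne Lu Lv; apply: uniqr Lv => //; rewrite eqxx in ne.
by apply: (uniq c) => //; [move: Lu|move: Lv]; rewrite catA => /fac[].
Qed.

(* The extension graph of [w] with respect to words of length [k] is the union
   of a star centered at [u0] and a star centered at [r0]. *)
Definition double_star (A : finType) (L : pred (seq A)) (k : nat) (w u0 r0 : seq A) :=
  [/\ size u0 = k, size r0 = k & forall u r, size u = k -> size r = k ->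
    L (u ++ w) -> L (w ++ r) -> L (u ++ w ++ r) = (u == u0) || (r == r0)].

(** Concentration gives [r0], and concentration in the mirrored language gives [u0]. An edge with
    [u != u0] and [r != r0] would let both [r] and [r0] follow [u ++ w], against uniqueness in the
    mirror. *)
Lemma eventually_double_star (A : finType) (L : pred (seq A)) m k :
  language L -> superadditive m (left_excess L) ->
  superadditive m (left_excess (L \o rev)) ->
  exists n, forall w, L w -> n <= size w -> exists u0 r0, double_star L k w u0 r0.
Proof.
move=> lang sL sR.
have [n1 conc1] := right_concentration_words k k lang sL.
have [n2 conc2] := right_concentration_words k k (language_rev lang) sR.
exists (maxn n1 n2) => w Lw; rewrite geq_max => /andP[w1 w2].
have [r0 [sr0 full1 uniq1]] := conc1 w Lw w1.
have [||u0' [su0 full2 uniq2]] := conc2 (rev w); rewrite /= ?revK ?size_rev //.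
exists (rev u0'), r0; split; rewrite ?size_rev // => u r su sr Lu Lr.
have [->|ur0] := eqVneq r r0; first by rewrite orbT full1.
have [->|uu0] := eqVneq u (rev u0') => /=.
  by have := full2 (rev r); rewrite /= !rev_cat !revK size_rev -catA; apply.
apply/negP=> Lur; have : rev r = rev r0; last by move/(can_inj revK)/eqP; apply/negP.
apply: (uniq2 (rev u)); rewrite ?size_rev //=.
- by apply: contraNneq uu0 => <-; rewrite revK.
- by rewrite !rev_cat !revK -catA.
- by rewrite !rev_cat !revK -catA full1.
Qed.

(** * Shift spaces *)

Lemma size_window (A : Type) (x : config A) i n : size (window x i n) = n.
Proof. exact: size_mkseq. Qed.

Lemma eq_window (A : Type) (x y : config A) i j n :
  window x i n = window y j n <->
  forall k, (0 <= k < Z.of_nat n)%Z -> x (i + k)%Z = y (j + k)%Z.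
Proof.
split=> [e k kn|e].
  have k' : Z.to_nat k < n by lia.
  have := congr1 (fun s => nth (x 0%Z) s (Z.to_nat k)) e.
  by rewrite !nth_mkseq // Z2Nat.id; last lia.
by apply/eq_in_map => k; rewrite mem_iota => kn; apply: e; lia.
Qed.

Lemma eq_window_at (A : Type) (x y : config A) i n j :
  window x i n = window y i n -> (i <= j < i + Z.of_nat n)%Z -> x j = y j.
Proof.
by move=> /eq_window e jb; have := e (j - i)%Z; rewrite Zplus_minus; apply; lia.
Qed.

Lemma window_cat (A : Type) (x : config A) i m n :
  window x i (m + n) = window x i m ++ window x (i + Z.of_nat m)%Z n.
Proof.
rewrite /window /mkseq iotaD map_cat add0n; congr cat.
rewrite -[m in iota m n]addn0 iotaDl -map_comp; apply: eq_map => k /=.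
by congr x; lia.
Qed.

Lemma window_cons (A : Type) (x : config A) i n :
  window x i n.+1 = x i :: window x (i + 1)%Z n.
Proof. by rewrite -add1n window_cat /window /= Z.add_0_r. Qed.

Lemma window_rcons (A : Type) (x : config A) i n :
  window x i n.+1 = rcons (window x i n) (x (i + Z.of_nat n)%Z).
Proof. rewrite -addn1 window_cat -cats1; congr (_ ++ [:: x _]); lia. Qed.

Lemma shift_invariant_translate (A : finType) (X : config A -> Prop) x j :
  shift_invariant X -> X x -> X (fun i => x (i + j)%Z).
Proof.
move=> inv Xx.
have fwd y : X y -> X (fun i => y (i + 1)%Z) by move=> Xy; apply/inv; exists y.
have bwd y : X y -> X (fun i => y (i - 1)%Z).
  move=> /inv[z [Xz e]]; rewrite (_ : (fun _ => _) = z) //.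
  by apply: funext => i; rewrite e /shift; congr z; lia.
pattern j; apply: Z.bi_induction => [|k].
  by rewrite (_ : (fun _ => _) = x) //; apply: funext => i; congr x; lia.
split=> [/fwd|/bwd]; congr X; apply: funext => i; congr x; lia.
Qed.

Lemma Lang_window (A : finType) (X : config A -> Prop) x i n :
  X x -> Lang X (window x i n).
Proof. by move=> Xx; exists x; split=> //; exists i; rewrite size_window. Qed.

Lemma Lang_at (A : finType) (X : config A -> Prop) w p :
  shift_invariant X -> Lang X w -> exists2 x, X x & window x p (size w) = w.
Proof.
move=> inv [x [Xx [i e]]]; exists (fun j => x (j + (i - p))%Z).
  exact: shift_invariant_translate (i - p)%Z inv Xx.
by rewrite -[RHS]e; apply/eq_window => k _; congr x; lia.
Qed.

Lemma language_Lang (A : finType) (X : config A -> Prop) :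
  language (fun w => `[< Lang X w >]).
Proof.
split=> [u v|w|w] /asboolP[x [Xx [i e]]].
- move: e; rewrite size_cat window_cat => /eqP.
  rewrite eqseq_cat ?size_window // => /andP[/eqP <- /eqP <-].
  by split; apply/asboolP; exact: Lang_window.
- exists (x (i - 1)%Z); apply/asboolP; rewrite -e.
  have := @Lang_window _ X x (i - 1)%Z (size w).+1 Xx.
  by rewrite window_cons Z.sub_add.
- exists (x (i + Z.of_nat (size w))%Z); apply/asboolP; rewrite -{1}e -window_rcons.
  exact: Lang_window.
Qed.

(** * Extension graphs: excess inequality and double stars *)

Lemma walkP (T : Type) (e : T -> T -> Prop) x p :
  walk e x p <-> path (fun x y => `[< e x y >]) x p.
Proof.
elim: p x => //= y p IH x; split=> [[/asboolP -> /IH]//|/andP[/asboolP exy /IH]//].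
Qed.

(** A vertex on a cycle has an incident edge, whose word contains the word of the vertex; this
    supplies the vertex condition of [graph_acyclic]. *)
Lemma ext_acyclic_cycle_free (A : finType) (X : config A -> Prop) w :
  graph_acyclic (ext_vertex X w) (ext_edge X w) ->
  cycle_free (fun x y => `[< ext_edge X w x y >]).
Proof.
have [fac _ _] := language_Lang X.
move=> acyc [//|x p] us ss; apply/negP => cyc.
apply: (acyc x p) => //; last exact/walkP.
move=> z zs; have := next_cycle cyc zs; move/asboolP.
case: z {zs} => a; case: (next _ _) => //= b /asboolP; last first.
  by rewrite -cat1s => /fac[_ /asboolP].
by rewrite -rcons_cons -cats1 => /fac[/asboolP].
Qed.

(** In the extension graph of [w], the degree of [b] counts the left extensions of [rcons w b], and
    by extendability the non-isolated [a] are the left extensions of [w]. *)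
Lemma acyclic_superadditive (A : finType) (X : config A -> Prop) m :
  (forall w, Lang X w -> m <= size w ->
     graph_acyclic (ext_vertex X w) (ext_edge X w)) ->
  superadditive m (left_excess (fun w => `[< Lang X w >])) /\
  superadditive m (left_excess ((fun w => `[< Lang X w >]) \o rev)).
Proof.
move=> acyc; have [fac extl extr] := language_Lang X.
have eq_sum_bool (B : finType) (P Q : B -> bool) : (forall b, P b -> Q b) ->
  (forall b, Q b -> P b) -> \sum_b P b = \sum_b Q b.
  move=> PQ QP; apply: eq_bigr => b _; congr nat_of_bool.
  by apply/idP/idP; [exact: PQ | exact: QP].
split=> w mw.
  have [Lw|Lw] := pselect (Lang X w); last first.
    rewrite big1 // => b _; rewrite /left_excess big1 // => a _.
    case: asboolP => // /asboolP.
    by rewrite -cat1s -cats1 => /fac[_ /fac[/asboolP]].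
  have /ext_acyclic_cycle_free cf := acyc w Lw mw.
  have e : \sum_a [exists b, `[< Lang X (a :: rcons w b) >]] =
           \sum_a `[< Lang X (a :: w) >].
    apply: eq_sum_bool => a.
      by move=> /existsP[b]; rewrite -rcons_cons -cats1 => /fac[].
    by move=> /extr[b] /= Lb; apply/existsP; exists b.
  rewrite /left_excess -e.
  apply: (@bipartite_cycle_free_excess A A (fun a b => `[< Lang X (a :: rcons w b) >])).
  congr cycle_free: cf; apply: funext => -[a|b]; apply: funext => -[a'|b'] //=;
  by apply: asboolF.
set w' := rev w.
have [Lw|Lw] := pselect (Lang X w'); last first.
  rewrite big1 // => b _; rewrite /left_excess big1 // => a _ /=.
  case: asboolP => // /asboolP; rewrite rev_cons rev_rcons.
  by rewrite -cats1 => /fac[]; rewrite -cat1s => /fac[_ /asboolP].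
have mw' : m <= size w' by rewrite size_rev.
have /ext_acyclic_cycle_free cf := acyc w' Lw mw'.
have e : \sum_a [exists b, `[< Lang X (b :: rcons w' a) >]] =
         \sum_a `[< Lang X (rev (a :: w)) >].
  apply: eq_sum_bool => a; rewrite rev_cons.
    by move=> /existsP[b]; rewrite -cat1s => /fac[].
  by move=> /extl[b] /= Lb; apply/existsP; exists b.
rewrite /left_excess /= -e.
under eq_bigr => b _ do under eq_bigr => a _ do rewrite rev_cons rev_rcons.
apply: (@bipartite_cycle_free_excess A A (fun a b => `[< Lang X (b :: rcons w' a) >])).
move=> s us ss.
(* The mirrored inequality uses the extension graph of [rev w] with its two sides exchanged. *)
pose f (x : A + A) := match x with inl a => inr a | inr a => inl a end.
have fI : injective f by case=> a [] b // [->].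
have := cf (map f s); rewrite map_inj_uniq // size_map cycle_map.
move=> /(_ us ss); apply: contra; apply: sub_cycle => -[a|b] [a'|b'] //=.
Qed.

(** Every vertex is within two edges of [a0]. A cycle contains a vertex other than the two centres,
    and such a vertex has a single neighbour. *)
Lemma double_star_tree (A : finType) (X : config A -> Prop) w a0 b0 :
  Lang X (a0 :: rcons w b0) ->
  (forall a b, Lang X (a :: rcons w b) ->
     [/\ a = a0 \/ b = b0, Lang X (a :: rcons w b0) & Lang X (a0 :: rcons w b)]) ->
  ext_graph_tree X w.
Proof.
move=> E0 star; have [fac extl extr] := language_Lang X; split.
  have to_a0 u : ext_vertex X w u ->
    clos_refl_trans _ (ext_edge X w) u (inl a0) /\
    clos_refl_trans _ (ext_edge X w) (inl a0) u.
    case: u => [a|b] /= /asboolP.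
      move=> /extr[b /asboolP/star[_ E1 _]].
      by split; apply: (@rt_trans _ _ _ (inr b0)); apply: rt_step.
    move=> /extl[a /asboolP/star[_ _ E1]].
    by split; apply: rt_step.
  move=> u v /to_a0[u1 _] /to_a0[_ v1]; exact: rt_trans u1 v1.
move=> x p _ us sp /walkP cyc.
set s := x :: p in us; have {}cyc : cycle (fun x y => `[< ext_edge X w x y >]) s by [].
have [z zs zN] : exists2 z, z \in s & z \notin [:: inl a0; inr b0].
  apply: contrapT => h; have /(uniq_leq_size us) : {subset s <= [:: inl a0; inr b0]}.
    by move=> z zs; apply/negPn/negP => zN; apply: h; exists z.
  by move=> /=; rewrite ltnS leqNgt sp.
have nbr y : ext_edge X w z y -> y = if z is inl _ then inr b0 else inl a0.
  case: z y zN {zs} => a [] b //=; rewrite !inE => aN /star[[e|e] _ _].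
  - by rewrite e eqxx in aN.
  - by rewrite e.
  - by rewrite e.
  - by rewrite e eqxx orbT in aN.
(* Once the cycle starts at [z], its second and last vertices are distinct neighbours of [z]. *)
have [i s' es] := rot_to zs.
have us' : uniq (z :: s') by rewrite -es rot_uniq.
have ss' : 2 <= size s' by have := congr1 size es; rewrite size_rot /= => -[<-].
have : cycle (fun x y => `[< ext_edge X w x y >]) (z :: s') by rewrite -es rot_cycle.
case/lastP: s' {es} us' ss' => // -[//|y s' y'] us' _.
rewrite /= !rcons_path => /and3P[/asboolP zy _ /asboolP].
rewrite last_rcons => y'z.
have zy' : ext_edge X w z y' by case: (z) (y') y'z => ? [].
move: us'; rewrite /= mem_rcons inE (nbr y zy) (nbr y' zy') eqxx /=.
by rewrite andbF.
Qed.

(** * Compactness and the radius of a conjugacy *)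

(** The cluster point [z] is the coordinatewise limit along an ultrafilter that contains the tails
    of the naturals. *)
Lemma config_compact (C : finType) (s : nat -> config C) :
  exists z : config C, forall n N, exists2 q, N <= q &
    forall i, (- Z.of_nat n <= i <= Z.of_nat n)%Z -> s q i = z i.
Proof.
have [U [UU ooU]] := ultraFilterLemma eventually_filter.
have lim i : exists c, U [set q | s q i = c]%classic.
  have : U [set q | s q i \in enum C]%classic.
    by apply: filterS filterT => q _ /=; rewrite mem_enum.
  elim: (enum C) => [|c l IH] Ul.
    by have /filter_ex[] := Ul.
  have [Uc|Uc] := in_ultra_setVsetC [set q | s q i = c]%classic UU; first by exists c.
  apply: IH; apply: filterS (filterI Ul Uc) => q [/=].
  by rewrite inE => /orP[/eqP//|].
have [z zP] := choice lim; exists z => n N.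
have Un : U [set q | forall i, (- Z.of_nat n <= i <= Z.of_nat n)%Z ->
                       s q i = z i]%classic.
  elim: n => [|n IH].
    apply: filterS (zP 0%Z) => q /= e i i0.
    by have -> : i = 0%Z by lia.
  apply: filterS (filterI IH (filterI (zP (Z.of_nat n.+1)) (zP (- Z.of_nat n.+1)%Z))).
  move=> q [/= h [e1 e2]] i ib.
  have [->//|[->//|ib']] : (i = Z.of_nat n.+1 \/ i = - Z.of_nat n.+1 \/
    - Z.of_nat n <= i <= Z.of_nat n)%Z by lia.
  exact: h.
have UN : U [set q | N <= q]%classic by apply: ooU; exists N.
by have [q [/= ? ?]] := filter_ex (filterI UN Un); exists q.
Qed.

(** Otherwise there are pairs that differ at 0 with images agreeing on ever larger windows; a
    cluster point of these pairs contradicts injectivity. *)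
Lemma block_code_injective_radius (A B : finType) (X : config A -> Prop)
    (phi : config A -> config B) m :
  closed_set X ->
  (forall x x' i, X x -> X x' ->
     (forall j, (i - Z.of_nat m <= j <= i + Z.of_nat m)%Z -> x j = x' j) ->
     phi x i = phi x' i) ->
  (forall x x', X x -> X x' -> (forall i, phi x i = phi x' i) ->
     forall i, x i = x' i) ->
  exists n, forall x x', X x -> X x' ->
    (forall i, (- Z.of_nat n <= i <= Z.of_nat n)%Z -> phi x i = phi x' i) ->
    x 0%Z = x' 0%Z.
Proof.
move=> cl loc inj; apply: contrapT => h.
have {}h n : exists xx : config A * config A, [/\ X xx.1, X xx.2,
    (forall i, (- Z.of_nat n <= i <= Z.of_nat n)%Z -> phi xx.1 i = phi xx.2 i)
    & xx.1 0%Z <> xx.2 0%Z].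
  apply: contrapT => hn; apply: h; exists n => x x' Xx Xx' e.
  by apply: contrapT => ne; apply: hn; exists (x, x').
have [s sP] := choice h.
(* Pairing the letters makes one cluster point serve both components. *)
have [z zP] := config_compact (fun q i => ((s q).1 i, (s q).2 i)).
have X1 : X (fun i => (z i).1).
  apply: cl => n; have [q _ e] := zP n 0; exists (s q).1; split; first by have [] := sP q.
  by move=> i /e <-.
have X2 : X (fun i => (z i).2).
  apply: cl => n; have [q _ e] := zP n 0; exists (s q).2; split; first by have [] := sP q.
  by move=> i /e <-.
have z12 : (z 0%Z).1 = (z 0%Z).2.
  apply: (inj _ _ X1 X2) => i.
  (* The window covers the [m]-neighbourhood of [i], and [q] is at least the absolute value of [i],
     so the two images agree at [i]. *)
  have [q qb e] := zP (Z.to_nat (Z.abs i) + m) (Z.to_nat (Z.abs i)).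
  have [Xq1 Xq2 eq _] := sP q.
  rewrite -(loc (s q).1 _ i Xq1 X1); last by move=> j jb; rewrite -e //; lia.
  rewrite -(loc (s q).2 _ i Xq2 X2); last by move=> j jb; rewrite -e //; lia.
  by apply: eq; lia.
have [q _ e] := zP 0 0; have [_ _ _] := sP q; apply.
by move: z12; rewrite -e; last lia.
Qed.

(** The code has radius [m + n] and its inverse has radius [q] at 0, hence everywhere because [phi]
    commutes with translations; the sum serves for both. *)
Lemma conjugacy_radius (A B : finType) (X : config A -> Prop)
    (Y : config B -> Prop) (phi : config A -> config B) :
  shift_space X -> sliding_block_code X Y phi ->
  (forall x x', X x -> X x' -> (forall i, phi x i = phi x' i) ->
     forall i, x i = x' i) ->
  exists r : nat,
    (forall x x' i, X x -> X x' ->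
      (forall j, (i - Z.of_nat r <= j <= i + Z.of_nat r)%Z -> x j = x' j) ->
      phi x i = phi x' i) /\
    (forall x x' i, X x -> X x' ->
      (forall j, (i - Z.of_nat r <= j <= i + Z.of_nat r)%Z -> phi x j = phi x' j) ->
      x i = x' i).
Proof.
move=> [cl inv] [_ [m [n [f fP]]]] inj.
have loc x x' i : X x -> X x' ->
    (forall j, (i - Z.of_nat (m + n) <= j <= i + Z.of_nat (m + n))%Z -> x j = x' j) ->
    phi x i = phi x' i.
  move=> Xx Xx' e; rewrite !fP //; congr f.
  by apply/eq_window => k kb; apply: e; lia.
have [q qP] := block_code_injective_radius cl loc inj.
have tr x i j : X x -> phi (fun k => x (k + i)%Z) j = phi x (j + i)%Z.
  move=> Xx; rewrite !fP //; last exact: (shift_invariant_translate i inv Xx).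
  by congr f; apply/eq_window => k _; congr x; lia.
exists (m + n + q); split=> x x' i Xx Xx' e.
  by apply: loc => // j jb; apply: e; lia.
have := qP (fun k => x (k + i)%Z) (fun k => x' (k + i)%Z); rewrite Z.add_0_l.
apply; [exact: (shift_invariant_translate i inv Xx) |
  exact: (shift_invariant_translate i inv Xx') |].
by move=> j jb; rewrite !tr //; apply: e; lia.
Qed.

(** * Transfer of double stars along a conjugacy *)

(* A point [x] of [X] whose image reads [v] on [[0, N)] reads a fixed word [W]
   on [[r, N - r)]; the letters [phi x (-1)] and [phi x N] depend only on the
   words of length [2 r + 1] surrounding [W].  So the extension graph of [v] is
   a projection of a part of the one of [W]. *)
Lemma conjugate_double_star (A B : finType) (X : config A -> Prop)
    (Y : config B -> Prop) (phi : config A -> config B) (r n : nat) (v : seq B) :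
  shift_invariant X -> shift_invariant Y ->
  (forall x, X x -> Y (phi x)) ->
  (forall y, Y y -> exists x, X x /\ forall i, phi x i = y i) ->
  (forall x x' i, X x -> X x' ->
     (forall j, (i - Z.of_nat r <= j <= i + Z.of_nat r)%Z -> x j = x' j) ->
     phi x i = phi x' i) ->
  (forall x x' i, X x -> X x' ->
     (forall j, (i - Z.of_nat r <= j <= i + Z.of_nat r)%Z -> phi x j = phi x' j) ->
     x i = x' i) ->
  (forall w, Lang X w -> n <= size w -> exists u0 r0,
     double_star (fun w => `[< Lang X w >]) (r + r).+1 w u0 r0) ->
  Lang Y v -> n + 4 * r <= size v ->
  exists a0 b0, Lang Y (a0 :: rcons v b0) /\
    forall a b, Lang Y (a :: rcons v b) ->
      [/\ a = a0 \/ b = b0, Lang Y (a :: rcons v b0) & Lang Y (a0 :: rcons v b)].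
Proof.
move=> invX invY phiXY surj loc loc' star Lv sv.
set N := size v; set k := (r + r).+1 in star *.
have lift i w : Lang Y w -> exists2 x, X x & window (phi x) i (size w) = w.
  move=> /(Lang_at i invY)[y /surj[x [Xx e]] yw]; exists x => //.
  by rewrite -[RHS]yw; apply/eq_window => j _; rewrite e.
pose C x := X x /\ window (phi x) 0%Z N = v.
(* These windows are centred at [-1] and [N] with radius [r], and they adjoin the window of [W], so
   [U x ++ W ++ R x] is read contiguously in [x]. *)
pose U (x : config A) := window x (- Z.of_nat r - 1)%Z k.
pose R (x : config A) := window x (Z.of_nat N - Z.of_nat r)%Z k.
have [xs Xs es] := lift 0%Z v Lv.
have Cs : C xs by [].
pose W := window xs (Z.of_nat r) (N - (r + r)).
have CW x : C x -> window x (Z.of_nat r) (N - (r + r)) = W.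
  move=> [Xx ex]; apply/eq_window => i ib; apply: loc' => // j jb.
  by apply: (eq_window_at (etrans ex (esym es))); lia.
have UWR x : C x ->
    window x (- Z.of_nat r - 1)%Z (k + (N - (r + r) + k)) = U x ++ W ++ R x.
  move=> Cx; rewrite !window_cat -(CW x Cx); congr (_ ++ (_ ++ _)); last first.
    by congr window; lia.
  by congr window; lia.
have LUWR x : C x -> Lang X (U x ++ W ++ R x).
  by move=> Cx; rewrite -UWR //; apply: Lang_window; case: Cx.
have [fac _ _] := language_Lang X.
have LU x : C x -> `[< Lang X (U x ++ W) >].
  by move=> /LUWR/asboolP; rewrite catA => /fac[].
have LR x : C x -> `[< Lang X (W ++ R x) >] by move=> /LUWR/asboolP/fac[].
have [||u0 [r0 [su0 sr0 ds]]] := star W.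
- exact: Lang_window.
- by rewrite size_window /N; lia.
have dsC x : C x -> (U x == u0) || (R x == r0).
  by move=> Cx; rewrite -ds ?size_window ?LU ?LR //; apply/asboolP; exact: LUWR.
have {}ds x y : C x -> C y -> (U x == u0) || (R y == r0) -> Lang X (U x ++ W ++ R y).
  move=> Cx Cy h; apply/asboolP; rewrite ds ?size_window //; [exact: LU | exact: LR].
have phiU x y : C x -> C y -> U x = U y -> phi x (-1)%Z = phi y (-1)%Z.
  move=> [Xx _] [Xy _] e; apply: loc => // j jb.
  by apply: (eq_window_at e); lia.
have phiR x y : C x -> C y -> R x = R y -> phi x (Z.of_nat N) = phi y (Z.of_nat N).
  move=> [Xx _] [Xy _] e; apply: loc => // j jb.
  by apply: (eq_window_at e); lia.
(* An edge between [U x] and [R y] is realized by a point [z] whose image still reads [v]. *)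
have glue x y : C x -> C y -> Lang X (U x ++ W ++ R y) ->
    exists z, [/\ C z, U z = U x & R z = R y].
  move=> Cx Cy /(Lang_at (- Z.of_nat r - 1)%Z invX)[z Xz].
  rewrite !size_cat !size_window => ez.
  have Uz : U z = U x.
    move: ez; rewrite window_cat => /eqP; rewrite eqseq_cat ?size_window //.
    by case/andP => /eqP.
  have [Wz Rz] : window z (Z.of_nat r) (N - (r + r)) = W /\ R z = R y.
    move: ez; rewrite !window_cat => /eqP; rewrite !eqseq_cat ?size_window //.
    case/and3P => _ /eqP <- /eqP <-.
    split; congr window; lia.
  exists z; split=> //; split=> //; have [Xx ex] := Cx; have [Xy ey] := Cy.
  have zx j : (- Z.of_nat r - 1 <= j < Z.of_nat N - Z.of_nat r)%Z -> z j = x j.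
    move=> jb; have [jr|jr] := Z.lt_ge_cases j (Z.of_nat r).
      by apply: (eq_window_at Uz); lia.
    by apply: (eq_window_at (etrans Wz (esym (CW x Cx)))); lia.
  have zy j : (Z.of_nat r <= j <= Z.of_nat N + Z.of_nat r)%Z -> z j = y j.
    move=> jb; have [jr|jr] := Z.lt_ge_cases j (Z.of_nat N - Z.of_nat r).
      by apply: (eq_window_at (etrans Wz (esym (CW y Cy)))); lia.
    by apply: (eq_window_at Rz); lia.
  rewrite -es; apply/eq_window => j jb; rewrite !Z.add_0_l.
  have at_v t : window (phi t) 0%Z N = v -> phi t j = phi xs j.
    by move=> et; apply: (eq_window_at (etrans et (esym es))); lia.
  (* As [N] is at least [4 r], the window of radius [r] around [j] lies where [z] agrees with [x] or
     where it agrees with [y]. *)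
  have [jr|jr] := Z.lt_ge_cases j (Z.of_nat N - 2 * Z.of_nat r).
    by rewrite -(at_v x ex); apply: loc => // i ib; apply: zx; lia.
  by rewrite -(at_v y ey); apply: loc => // i ib; apply: zy; lia.
have edge x : C x -> Lang Y (phi x (-1)%Z :: rcons v (phi x (Z.of_nat N))).
  move=> [Xx ex]; have := @Lang_window _ Y (phi x) (-1)%Z N.+2 (phiXY x Xx).
  by rewrite window_cons window_rcons ex.
have edge_lift a b : Lang Y (a :: rcons v b) ->
    exists x, [/\ C x, phi x (-1)%Z = a & phi x (Z.of_nat N) = b].
  move=> /(lift (-1)%Z)[x Xx]; rewrite /= size_rcons window_cons window_rcons.
  by case=> ea /eqP; rewrite eqseq_rcons => /andP[/eqP ev /eqP eb]; exists x.
(* The centres [u0] and [r0] need not come from points of [C]. If one of them does not, the other is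
   common to all points of [C] and [xs] will do; if both do, gluing yields [x0]. *)
have [x0 [C0 x0P]] : exists x0, C x0 /\ forall x, C x ->
    [/\ U x = U x0 \/ R x = R x0, Lang X (U x ++ W ++ R x0)
      & Lang X (U x0 ++ W ++ R x)].
  have [[x1 [C1 U1]]|noU] := pselect (exists x, C x /\ U x = u0); last first.
    have R0 x : C x -> R x = r0.
      move=> Cx; have /orP[/eqP Ux|/eqP//] := dsC x Cx.
      by case: noU; exists x.
    exists xs; split=> // x Cx; split; first by right; rewrite !R0.
      by apply: ds => //; rewrite R0 ?eqxx ?orbT.
    by apply: ds => //; rewrite R0 ?eqxx ?orbT.
  have [[x2 [C2 R2]]|noR] := pselect (exists x, C x /\ R x = r0); last first.
    have U0 x : C x -> U x = u0.
      move=> Cx; have /orP[/eqP//|/eqP Rx] := dsC x Cx.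
      by case: noR; exists x.
    exists xs; split=> // x Cx; split; first by left; rewrite !U0.
      by apply: ds => //; rewrite U0 ?eqxx.
    by apply: ds => //; rewrite U0 ?eqxx.
  have [|x0 [C0 U0 R0]] := glue x1 x2 C1 C2.
    by apply: ds => //; rewrite U1 eqxx.
  exists x0; split=> // x Cx; rewrite U0 U1 R0 R2; split.
  - by have /orP[/eqP|/eqP] := dsC x Cx; [left|right].
  - by rewrite -R2; apply: ds => //; rewrite R2 eqxx orbT.
  - by rewrite -U1; apply: ds => //; rewrite U1 eqxx.
exists (phi x0 (-1)%Z), (phi x0 (Z.of_nat N)); split; first exact: edge.
move=> a b /edge_lift[x [Cx <- <-]]; have [ux l1 l2] := x0P x Cx; split.
- by case: ux => e; [left; apply: phiU | right; apply: phiR].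
- have [z [Cz Uz Rz]] := glue x x0 Cx C0 l1.
  by rewrite -(phiU z x) // -(phiR z x0) //; exact: edge.
- have [z [Cz Uz Rz]] := glue x0 x C0 Cx l2.
  by rewrite -(phiU z x0) // -(phiR z x) //; exact: edge.
Qed.

Theorem mainTheorem10 (A B : finType) (X : config A -> Prop) (Y : config B -> Prop) :
  shift_space X -> shift_space Y -> conjugate X Y ->
  eventually_dendric X -> eventually_dendric Y.
Proof.
move=> sX [_ invY] [phi [code [inj surj]]] [m tree].
have [r [loc loc']] := conjugacy_radius sX code inj.
have [sL sR] : superadditive m (left_excess (fun w => `[< Lang X w >])) /\
    superadditive m (left_excess ((fun w => `[< Lang X w >]) \o rev)).
  by apply: acyclic_superadditive => w Lw mw; have [] := tree w Lw mw.
have [n star] := eventually_double_star (r + r).+1 (language_Lang X) sL sR.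
exists (n + 4 * r) => v Lv sv.
have [|a0 [b0 [E0 E]]] := conjugate_double_star sX.2 invY code.1 surj loc loc' _ Lv sv.
  by move=> w Lw; apply: star; apply/asboolP.
exact: double_star_tree E0 E.
Qed.
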